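(* Let $F$ be a field, and let $R$ be the Grams' ring over $F$. If $|F| = \infty$ (in particular, if $F$ has characteristic zero), then $\mathrm{Int}(R) = R[x]$, and this ring is an atomic domain that does not satisfy the ascending chain condition on principal ideals (ACCP).
   Context: For an integral domain $R$ with quotient field $K$, $\mathrm{Int}(R) := \{p(x) \in K[x] \mid p(R) \subseteq R\}$ is the ring of integer-valued polynomials of $R$. An integral domain is atomic if every nonzero nonunit is a finite product of irreducibles. It satisfies the ACCP if every ascending chain of principal ideals stabilizes. Grams' ring: let $(p_n)_{n \in \mathbb{N}_0}$ (where $\mathbb{N}_0 = \{0,1,2,\dots\}$) be the strictly increasing sequence whose terms are the odd primes, and let $M$ be the additive submonoid of $\mathbb{Q}_{\ge 0}$ generated by $\left\{ \frac{1}{2^n p_n} \mid n \in \mathbb{N}_0 \right\}$. For a field $F$, let $F[t;M]$ be the monoid ring of $M$ over $F$, i.e., the ring of polynomial expressions $\sum_i c_i t^{m_i}$ with coefficients $c_i \in F$ and exponents $m_i \in M$ (it is an integral domain). For $f \in F[t;M]$, $f(0)$ denotes the coefficient of $t^0$ in $f$. The Grams' ring over $F$ is the localization of $F[t;M]$ at the multiplicative set $\{f(t) \in F[t;M] \mid f(0) \neq 0\}$. *)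

(* Defs.v *)
From HB Require Import structures.
From mathcomp Require Import all_boot all_order all_algebra finmap.
From mathcomp Require Import boolp classical_sets cardinality.
From mathcomp.multinomials Require Export monalg.

Set Implicit Arguments.
Unset Strict Implicit.
Unset Printing Implicit Defensive.

Import Order.TTheory GRing.Theory Num.Theory.

Local Open Scope ring_scope.

(* MathComp's [idomainType] extends [comUnitRingType], so it comes with a boolean
   unit test and a total inverse.  [cunit] and [cinv] provide them classically on
   an arbitrary commutative ring: [cunit x] holds iff x has an inverse. *)
Section ClassicalUnits.
Variable R : comNzRingType.

Definition cunit : {pred R} := fun x => `[< exists y, y * x = 1 >].

Definition cinv (x : R) : R :=
  if pselect (exists y, y * x = 1) is left ex_y then projT1 (cid ex_y) else x.

Lemma cmulVr : {in cunit, left_inverse 1 cinv *%R}.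
Proof.
by move=> x /asboolP ux; rewrite /cinv; case: pselect => // ex_y; case: cid.
Qed.

Lemma cunitPl x y : y * x = 1 -> cunit x.
Proof. by move=> yx; apply/asboolP; exists y. Qed.

Lemma cinv_out : {in [predC cunit], cinv =1 id}.
Proof. by move=> x /asboolP nux; rewrite /cinv; case: pselect. Qed.

End ClassicalUnits.

Section Factorization.
Variable R : idomainType.

Definition irreducible_elt (a : R) : Prop :=
  [/\ a != 0, a \isn't a GRing.unit &
      forall b c, a = b * c -> b \is a GRing.unit \/ c \is a GRing.unit].

Definition atomic : Prop :=
  forall a : R, a != 0 -> a \isn't a GRing.unit ->
    exists s : seq R,
      (forall b, b \in s -> irreducible_elt b) /\ a = \prod_(b <- s) b.

Definition principal_ideal (a : R) : set R := [set b | exists c, b = c * a]%classic.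

Definition ACCP : Prop :=
  forall a : nat -> R,
    (forall n, principal_ideal (a n) `<=` principal_ideal (a n.+1))%classic ->
    exists N, forall n, (N <= n)%N -> principal_ideal (a n) = principal_ideal (a N).

End Factorization.

Section IntegerValued.
Variable R : idomainType.

Definition int_valued : {pred {poly {fraction R}}} :=
  fun p => `[< forall a : R, exists b : R,
    p.[FracField.tofrac a] = FracField.tofrac b >].

Fact int_valued_subring : subring_closed int_valued.
Proof.
split=> [|p q /asboolP pP /asboolP qP|p q /asboolP pP /asboolP qP];
  apply/asboolP=> a.
- by exists 1; rewrite hornerC rmorph1.
- have [b pb] := pP a; have [c qc] := qP a.
  by exists (b - c); rewrite hornerD hornerN pb qc rmorphB.
- have [b pb] := pP a; have [c qc] := qP a.
  by exists (b * c); rewrite hornerM pb qc rmorphM.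
Qed.
HB.instance Definition _ :=
  GRing.isSubringClosed.Build _ int_valued int_valued_subring.

Record intPoly := IntPoly {
  intPoly_val :> {poly {fraction R}};
  _ : intPoly_val \in int_valued
}.

HB.instance Definition _ := [isSub for intPoly_val].
HB.instance Definition _ := [Choice of intPoly by <:].
HB.instance Definition _ := [SubChoice_isSubComNzRing of intPoly by <:].
HB.instance Definition _ := GRing.ComNzRing_hasMulInverse.Build intPoly
  (@cmulVr intPoly) (@cunitPl intPoly) (@cinv_out intPoly).

Fact intPoly_integral : GRing.integral_domain_axiom intPoly.
Proof.
move=> p q /(congr1 val)/eqP; rewrite rmorphM rmorph0 mulf_eq0.
by rewrite -!(inj_eq val_inj) rmorph0.
Qed.
HB.instance Definition _ :=
  GRing.ComUnitRing_isIntegral.Build intPoly intPoly_integral.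

End IntegerValued.

Arguments int_valued R : clear implicits.

Fact next_prime_ex (m : nat) : exists p, (m < p)%N && prime p.
Proof. by have [p mp pp] := prime_above m; exists p; rewrite mp. Qed.

Definition next_prime (m : nat) : nat := ex_minn (next_prime_ex m).

Definition odd_prime_seq (n : nat) : nat := iter n next_prime 3.

Lemma odd_prime_seq_prime n : prime (odd_prime_seq n).
Proof.
case: n => [//|n]; rewrite /odd_prime_seq iterS /next_prime.
by case: ex_minnP => p /andP[].
Qed.

Lemma odd_prime_seq_lt n : (odd_prime_seq n < odd_prime_seq n.+1)%N.
Proof.
by rewrite /odd_prime_seq iterS /next_prime; case: ex_minnP => p /andP[].
Qed.

Lemma odd_prime_seqP q :
  reflect (exists n, odd_prime_seq n = q) (prime q && odd q).
Proof.
have ge3 n : (3 + n <= odd_prime_seq n)%N.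
  by elim: n => // n IHn; rewrite addnS (leq_ltn_trans IHn) ?odd_prime_seq_lt.
apply: (iffP andP) => [[q_pr q_odd]|[n <-]]; last first.
  split; first exact: odd_prime_seq_prime.
  case/even_prime: (odd_prime_seq_prime n) => // n2.
  by have := ge3 n; rewrite n2.
have q3 : (odd_prime_seq 0 <= q)%N by case: q q_pr q_odd => [|[|[|]]].
have ex_n : exists n, (q <= odd_prime_seq n)%N.
  by exists q; apply: leq_trans (ge3 q); apply: leq_addl.
case: (ex_minnP ex_n) => n qn n_min; exists n.
apply/eqP; rewrite eqn_leq qn andbT.
case: n qn n_min => [//|n] _ n_min.
have nq : (odd_prime_seq n < q)%N by rewrite ltnNge; apply/negP=> /n_min; rewrite ltnn.
rewrite {1}/odd_prime_seq iterS /next_prime; case: ex_minnP => p _; apply.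
by rewrite q_pr andbT.
Qed.

Definition grams_generator (n : nat) : rat :=
  (2 ^+ n * (odd_prime_seq n)%:R)^-1.

Definition grams_exponent : {pred rat} :=
  fun q => `[< exists s : seq nat, q = \sum_(n <- s) grams_generator n >].

Fact grams_exponent_addr : addr_closed grams_exponent.
Proof.
split=> [|x y /asboolP[s ->] /asboolP[t ->]]; apply/asboolP.
  by exists [::]; rewrite big_nil.
by exists (s ++ t); rewrite big_cat.
Qed.
HB.instance Definition _ :=
  GRing.isAddClosed.Build _ grams_exponent grams_exponent_addr.

Lemma grams_exponent_ge0 q : q \in grams_exponent -> 0 <= q.
Proof.
move=> /asboolP[s ->]; apply: sumr_ge0 => n _.
by rewrite invr_ge0 mulr_ge0 ?exprn_ge0 ?ler0n.
Qed.

Record gramsMonoid := GramsMonoid {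
  grams_val :> rat;
  _ : grams_val \in grams_exponent
}.

HB.instance Definition _ := [isSub for grams_val].
HB.instance Definition _ := [Choice of gramsMonoid by <:].

(* [monalg] writes the exponent monoid multiplicatively: below, [mone] is the
   rational number 0 and [mmul] is the addition of rational numbers. *)
Definition grams_zero : gramsMonoid := GramsMonoid (rpred0 grams_exponent).
Definition grams_add (x y : gramsMonoid) : gramsMonoid :=
  GramsMonoid (rpredD (valP x) (valP y)).

Fact grams_addA : associative grams_add.
Proof. by move=> x y z; apply: val_inj; rewrite /= addrA. Qed.
Fact grams_addC : commutative grams_add.
Proof. by move=> x y; apply: val_inj; rewrite /= addrC. Qed.
Fact grams_add0 : left_id grams_zero grams_add.
Proof. by move=> x; apply: val_inj; rewrite /= add0r. Qed.
Fact grams_addr0 : right_id grams_zero grams_add.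
Proof. by move=> x; apply: val_inj; rewrite /= addr0. Qed.
Fact grams_add_eq0 x y :
  grams_add x y = grams_zero -> x = grams_zero /\ y = grams_zero.
Proof.
move=> /(congr1 val) /= /eqP.
rewrite paddr_eq0 ?(grams_exponent_ge0 (valP _)) // => /andP[/eqP x0 /eqP y0].
by split; apply: val_inj.
Qed.

HB.instance Definition _ := Choice_isMonomialDef.Build gramsMonoid
  grams_addA grams_add0 grams_addr0 grams_add_eq0.
HB.instance Definition _ :=
  MonomialDef_isConomialDef.Build gramsMonoid grams_addC.

Section MonoidRing.
Variable F : fieldType.

HB.instance Definition _ :=
  GRing.ComNzRing_hasMulInverse.Build (malg gramsMonoid F)
    (@cmulVr {malg F[gramsMonoid]}) (@cunitPl {malg F[gramsMonoid]})
    (@cinv_out {malg F[gramsMonoid]}).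

Lemma malg_leading (f : {malg F[gramsMonoid]}) : f != 0 ->
  exists2 k, k \in msupp f & forall l, l \in msupp f -> val l <= val k.
Proof.
rewrite -msupp_eq0 => /fset0Pn[a0 a0f].
suff max (s : seq gramsMonoid) : s != [::] ->
    exists2 k, k \in s & forall l, l \in s -> val l <= val k.
  by apply: (max (enum_fset (msupp f))); apply: contraTneq a0f => /= s0;
    rewrite [_ \in _](_ : _ = (a0 \in enum_fset (msupp f))) // s0.
elim: s => // a [|b s] IHs _.
  by exists a; rewrite ?mem_head // => l; rewrite inE => /eqP->.
have [//|k ks k_max] := IHs; have [ak|ka] := lerP (val a) (val k).
  exists k => [|l]; rewrite inE ?ks ?orbT // => /predU1P[->//|].
  exact: k_max.
exists a => [|l]; rewrite inE ?eqxx // => /predU1P[->//|/k_max].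
by move/le_trans; apply; apply: ltW.
Qed.

Fact malg_integral : GRing.integral_domain_axiom {malg F[gramsMonoid]}.
Proof.
move=> f g fg0; apply: contra_eqT fg0; rewrite negb_or => /andP[f0 g0].
have [k kf k_max] := malg_leading f0; have [l lg l_max] := malg_leading g0.
apply/eqP=> /(congr1 (mcoeff (mmul k l))); rewrite mcoeff0 mcoeffMl.
have eq_top i j : i \in msupp f -> j \in msupp g ->
    mmul i j = mmul k l -> i = k /\ j = l.
  move=> /k_max ik /l_max jl /(congr1 val) /= ijkl.
  suff ik_eq : val i = val k.
    split; apply: val_inj => //.
    by move: ijkl; rewrite /= -[grams_val i]/(val i) ik_eq => /addrI.
  apply/eqP; rewrite eq_le ik /= leNgt; apply/negP=> lt_ik.
  by have := ltr_leD lt_ik jl; rewrite /= ijkl ltxx.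
rewrite (bigD1_seq k) ?fset_uniq //= (bigD1_seq l) ?fset_uniq //= eqxx mulr1n.
rewrite big_seq_cond big1 ?addr0 => [|j /andP[jg jl]]; last first.
  by case: eqP => [/(eq_top _ _ kf jg)[_ jl_eq]|_]; rewrite ?mulr0n // jl_eq eqxx in jl.
rewrite big_seq_cond big1 ?addr0 => [|i /andP[fi ik]]; last first.
  rewrite big_seq big1 // => j gj.
  by case: eqP => [/(eq_top _ _ fi gj)[ik_eq _]|_]; rewrite ?mulr0n // ik_eq eqxx in ik.
by move/eqP; rewrite mulf_eq0 !mcoeff_eq0 kf lg.
Qed.
HB.instance Definition _ :=
  GRing.ComUnitRing_isIntegral.Build (malg gramsMonoid F) malg_integral.

End MonoidRing.

Section GramsRing.
Variable F : fieldType.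

Local Notation A := {malg F[gramsMonoid]}.

(* As the monoid ring is a domain and its elements with nonzero constant
   coefficient are nonzero, its localization at them is the subring of its
   fraction field consisting of the quotients with such a denominator. *)
Definition grams_fraction : {pred {fraction A}} :=
  fun x => `[< exists f g : A,
    g@_mone != 0 /\
    x = FracField.tofrac f / FracField.tofrac g >].

Fact grams_fraction_subring : subring_closed grams_fraction.
Proof.
have nz (g : A) : g@_mone != 0 -> FracField.tofrac g != 0.
  by rewrite tofrac_eq0; apply: contraNneq => ->; rewrite mcoeff0.
have nzM (g h : A) : g@_mone != 0 ->
    h@_mone != 0 -> (g * h)@_mone != 0.
  by move=> g0 h0; rewrite rmorphM mulf_neq0.
split=> [|x y /asboolP[f [g [g0 ->]]] /asboolP[h [k [k0 ->]]]
         |x y /asboolP[f [g [g0 ->]]] /asboolP[h [k [k0 ->]]]];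
  apply/asboolP.
- by exists 1, 1; rewrite rmorph1 oner_neq0 rmorph1 divr1.
- exists (f * k - h * g), (g * k); split; first exact: nzM.
  by rewrite rmorphB !rmorphM /= -[in LHS]mulNr addf_div ?nz // mulNr.
- exists (f * h), (g * k); split; first exact: nzM.
  by rewrite !rmorphM /= mulf_div.
Qed.
HB.instance Definition _ :=
  GRing.isSubringClosed.Build _ grams_fraction grams_fraction_subring.

Record gramsRing := GramsRing {
  gramsRing_val :> {fraction A};
  _ : gramsRing_val \in grams_fraction
}.

HB.instance Definition _ := [isSub for gramsRing_val].
HB.instance Definition _ := [Choice of gramsRing by <:].
HB.instance Definition _ := [SubChoice_isSubComNzRing of gramsRing by <:].
HB.instance Definition _ := GRing.ComNzRing_hasMulInverse.Build gramsRing
  (@cmulVr gramsRing) (@cunitPl gramsRing) (@cinv_out gramsRing).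

Fact gramsRing_integral : GRing.integral_domain_axiom gramsRing.
Proof.
move=> x y /(congr1 val)/eqP; rewrite rmorphM rmorph0 mulf_eq0.
by rewrite -!(inj_eq val_inj) rmorph0.
Qed.
HB.instance Definition _ :=
  GRing.ComUnitRing_isIntegral.Build gramsRing gramsRing_integral.

End GramsRing.

(* Main.v *)
Require Import Defs.
From HB Require Import structures.
From mathcomp Require Import all_boot all_order all_algebra finmap.
From mathcomp Require Import boolp classical_sets functions cardinality.
From mathcomp Require Import ring.

(** Write M for the exponent monoid, A = F[t;M] for the monoid ring and R for
its localization, a local ring with residue field F.

Int(R) = R[x].  Distinct elements of F differ by a unit of F, hence of R.  So
if a polynomial p takes values in R on all but finitely many elements of the
infinite set F, then so does its Newton quotient (p - p(a)) / (x - a), which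
has smaller degree; induction on the degree gives p in R[x]
([interpolation]).

R[x] is atomic.  In M, p_n copies of the generator 1/(2^n p_n) add up to
1/2^n, so every element of M is a nonnegative dyadic rational plus a sum of
generators in which the n-th one occurs fewer than p_n times; looking at
denominators modulo each p_n shows that this expression is unique
([reduced_perm]).  Call an exponent pure when no positive dyadic rational
divides it: then all ways of writing it as a sum of generators have the same
length ([pure_size]).  Up to a unit, a nonzero element of R[x] is a polynomial
G over A.  Dividing G by t^d, for d the least dyadic part of its exponents,
leaves a polynomial H with a pure exponent ([pure_factor]).  The factor t^d is
a product of monomials t^(1/(2^n p_n)), which are irreducible.  As for H, its
least pure exponent also occurs in u H for every u in A with nonzero constant
coefficient ([pure_occurs_stable]).  In a factorization of H into nonunits,
each factor either has positive degree in x or is a constant without constant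
coefficient, and a product with k factors of the second kind only involves
exponents that are sums of at least k generators.  The degree of H and the
length of its least pure exponent therefore bound the number of factors
([size_factorization]), and an element whose factorizations into nonunits have
bounded length is a product of irreducibles ([factorable_bounded]).

ACCP fails because of the principal ideals generated by the t^(1/2^n): each
t^(1/2^n) is the square of the next one, which is not a unit. *)

Import Order.TTheory GRing.Theory Num.Theory.
Local Open Scope ring_scope.
Local Open Scope classical_set_scope.

(** * Arithmetic of the exponent monoid *)

(** Membership in the localization of the integers at the prime ideal (p). *)
Definition p_integral (p : nat) (x : rat) : Prop :=
  exists2 D : nat, ~~ (p %| D)%N & x * D%:R \is a Num.int.

Lemma p_integralB p x y : prime p ->
  p_integral p x -> p_integral p y -> p_integral p (x - y).
Proof.
move=> p_pr [D pD xD] [E pE yE]; exists (D * E)%N.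
  by rewrite Euclid_dvdM // negb_or pD.
have -> : (x - y) * (D * E)%:R = x * D%:R * E%:R - y * E%:R * D%:R.
  by rewrite natrM; ring.
by rewrite rpredB // rpredM // rpred_nat.
Qed.

Lemma p_integral0 p : prime p -> p_integral p 0.
Proof.
by move=> p_pr; exists 1%N; rewrite ?mul0r ?rpred0 // dvdn1 neq_ltn prime_gt1 ?orbT.
Qed.

Lemma p_integralD p x y : prime p ->
  p_integral p x -> p_integral p y -> p_integral p (x + y).
Proof.
move=> p_pr px py; rewrite -[y]opprK; apply: p_integralB => //.
by rewrite -sub0r; apply: p_integralB => //; apply: p_integral0.
Qed.

(** Nonnegative by design: these are the dyadic elements of the exponent monoid. *)
Definition dyadic (d : rat) : Prop := exists k n : nat, d = k%:R / 2 ^+ n.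

Definition gsum (s : seq nat) : rat := \sum_(n <- s) grams_generator n.

Definition reduced (s : seq nat) : Prop :=
  forall n, (count_mem n s < odd_prime_seq n)%N.

(** A crude bound, enough to separate the odd primes from 2 and from 1. *)
Lemma odd_prime_seq_ge3 n : (3 + n <= odd_prime_seq n)%N.
Proof.
by elim: n => // n IHn; rewrite addnS (leq_ltn_trans IHn) ?odd_prime_seq_lt.
Qed.

Lemma odd_prime_seq_inj : injective odd_prime_seq.
Proof.
have lt i j : (i < j)%N -> (odd_prime_seq i < odd_prime_seq j)%N.
  by move: i j; apply: (homo_ltn (r := fun x y => (x < y)%N)) odd_prime_seq_lt;
    exact: ltn_trans.
move=> i j eq_ij; case: (ltngtP i j) => // /lt; by rewrite eq_ij ltnn.
Qed.

Lemma odd_prime_seq_ndvd2X i n : ~~ (odd_prime_seq i %| 2 ^ n)%N.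
Proof.
have p_pr := odd_prime_seq_prime i; rewrite Euclid_dvdX // negb_and.
rewrite dvdn_prime2 //; have := odd_prime_seq_ge3 i.
by case: eqP => // ->.
Qed.

Lemma grams_generator_gt0 n : 0 < grams_generator n.
Proof.
by rewrite invr_gt0 mulr_gt0 ?exprn_gt0 ?ltr0n ?prime_gt0 ?odd_prime_seq_prime.
Qed.

(** This carry rule is the only relation between the generators that matters: it
is what puts every dyadic rational into the monoid. *)
Lemma grams_generatorMp n :
  grams_generator n *+ odd_prime_seq n = (2 ^+ n)^-1.
Proof.
rewrite -[LHS]mulr_natr /grams_generator invfM mulfVK //.
by rewrite pnatr_eq0 -lt0n prime_gt0 ?odd_prime_seq_prime.
Qed.

Lemma dyadic_ge0 d : dyadic d -> 0 <= d.
Proof. by move=> [k [n ->]]; rewrite divr_ge0 ?exprn_ge0 ?ler0n. Qed.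

Lemma dyadic0 : dyadic 0.
Proof. by exists 0%N, 0%N; rewrite mul0r. Qed.

Lemma dyadicD d e : dyadic d -> dyadic e -> dyadic (d + e).
Proof.
move=> [k [n ->]] [l [m ->]]; exists (k * 2 ^ m + l * 2 ^ n)%N, (n + m)%N.
by rewrite addf_div ?expf_neq0 // exprD natrD !natrM !natrX.
Qed.

Lemma dyadicB d e : dyadic d -> dyadic e -> d <= e -> dyadic (e - d).
Proof.
move=> [k [n ->]] [l [m ->]] de; exists (l * 2 ^ n - k * 2 ^ m)%N, (n + m)%N.
have le : (k * 2 ^ m <= l * 2 ^ n)%N.
  rewrite -(ler_nat rat) !natrM !natrX.
  by rewrite -ler_pdivrMr ?exprn_gt0 // mulrAC -ler_pdivlMr ?exprn_gt0.
rewrite natrB // !natrM !natrX -mulNr addf_div ?expf_neq0 // mulNr.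
by rewrite exprD [2 ^+ m * _]mulrC.
Qed.

Lemma dyadicV n : dyadic (2 ^+ n)^-1.
Proof. by exists 1%N, n; rewrite mul1r. Qed.

Lemma dyadic_p_integral i d : dyadic d -> p_integral (odd_prime_seq i) d.
Proof.
move=> [k [n ->]]; exists (2 ^ n)%N; first exact: odd_prime_seq_ndvd2X.
by rewrite natrX mulfVK ?expf_neq0 // rpred_nat.
Qed.

Lemma generator_p_integral i j : i != j ->
  p_integral (odd_prime_seq i) (grams_generator j).
Proof.
move=> ij; have p_pr := odd_prime_seq_prime.
exists (2 ^ j * odd_prime_seq j)%N; last first.
  rewrite /grams_generator natrM natrX mulVf // mulf_neq0 ?expf_neq0 //.
  by rewrite pnatr_eq0 -lt0n prime_gt0.
rewrite Euclid_dvdM // negb_or odd_prime_seq_ndvd2X /= dvdn_prime2 //.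
by apply: contra ij => /eqP/odd_prime_seq_inj->.
Qed.

(** Localizing at p_i isolates the multiplicity of the i-th generator, since all
the other generators have denominators prime to p_i. *)
Lemma gsum_p_integral i s : exists2 x, p_integral (odd_prime_seq i) x &
  gsum s = grams_generator i *+ count_mem i s + x.
Proof.
have p_pr := odd_prime_seq_prime i.
exists (\sum_(n <- s | n != i) grams_generator n).
  apply: big_ind => [|x y|n ni]; [exact: p_integral0 | exact: p_integralD|].
  by apply: generator_p_integral; rewrite eq_sym.
rewrite /gsum (bigID (pred1 i)) /=; congr (_ + _).
rewrite (eq_bigr (fun=> grams_generator i)) => [|n /eqP-> //].
by rewrite big_const_seq iter_addr_0.
Qed.

Lemma generatorM_p_integral i c : (c < odd_prime_seq i)%N ->
  p_integral (odd_prime_seq i) (grams_generator i *+ c) -> c = 0%N.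
Proof.
set p := odd_prime_seq i => cp [D pD /intrP[z zE]].
have p_pr : prime p by apply: odd_prime_seq_prime.
have : (c * D)%:R = (z * (2 ^ i * p)%N%:Z)%:~R :> rat.
  rewrite intrM -zE natrM -pmulrn [in RHS]natrM natrX -mulr_natr.
  rewrite /grams_generator -/p.
  have p0 : p%:R != 0 :> rat by rewrite pnatr_eq0 -lt0n prime_gt0.
  by field; rewrite p0 expf_neq0.
rewrite pmulrn => /intr_inj cDz.
have : (p%:Z %| (c * D)%N%:Z)%Z by rewrite cDz PoszM mulrA dvdz_mull.
rewrite dvdzE !absz_nat Euclid_dvdM // (negPf pD) orbF.
by case: c cp {zE cDz} => // c cp /(dvdn_leq (ltn0Sn c)); rewrite leqNgt cp.
Qed.

(** The difference of the two multiplicities of i, times the i-th generator, is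
integral at p_i; so p_i divides that difference, which is smaller than p_i. *)
Lemma reduced_perm d e s t : dyadic d -> dyadic e -> reduced s -> reduced t ->
  d + gsum s = e + gsum t -> perm_eq s t.
Proof.
move=> dd de rs rt; suff le s' t' i d' e' : dyadic d' -> dyadic e' ->
    reduced s' -> reduced t' -> d' + gsum s' = e' + gsum t' ->
    (count_mem i s' <= count_mem i t')%N.
  move=> dsE; apply/allP => i _; apply/eqP/anti_leq/andP; split.
    exact: (le _ _ _ d e).
  exact: (le _ _ _ e d).
move=> dd' de' rs' rt' dsE; have p_pr := odd_prime_seq_prime i.
have [x px sE] := gsum_p_integral i s'; have [y py tE] := gsum_p_integral i t'.
rewrite leqNgt; apply/negP=> lt_ts.
suff /eqP : (count_mem i s' - count_mem i t' = 0)%N.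
  by rewrite subn_eq0 leqNgt lt_ts.
apply: (@generatorM_p_integral i).
  by apply: leq_ltn_trans (rs' i); apply: leq_subr.
rewrite mulrnBr 1?ltnW //.
rewrite (_ : _ - _ = (e' + y) - (d' + x)); last first.
  by move: dsE; rewrite sE tE => /(canRL (addKr _)) /(canRL (addrK _)) ->; ring.
by apply: p_integralB => //; apply: p_integralD => //; apply: dyadic_p_integral.
Qed.

Lemma gsum_cat s t : gsum (s ++ t) = gsum s + gsum t.
Proof. by rewrite /gsum big_cat. Qed.

Lemma gsum_perm s t : perm_eq s t -> gsum s = gsum t.
Proof. by move=> st; apply: perm_big. Qed.

Lemma gsum_carry n s : (odd_prime_seq n <= count_mem n s)%N ->
  exists2 t, (size t < size s)%N & gsum s = (2 ^+ n)^-1 + gsum t.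
Proof.
move=> le; set c := count_mem n s in le.
exists (nseq (c - odd_prime_seq n) n ++ filter (predC1 n) s).
  rewrite size_cat size_nseq size_filter -(count_predC (pred1 n) s) -/c.
  have p0 := prime_gt0 (odd_prime_seq_prime n).
  by rewrite ltn_add2r ltn_subrL p0 (leq_trans p0 le).
have nseqE m : gsum (nseq m n) = grams_generator n *+ m.
  by rewrite /gsum big_nseq iter_addr_0.
have -> : gsum s = gsum (nseq c n) + gsum (filter (predC1 n) s).
  rewrite -gsum_cat; apply: gsum_perm.
  rewrite -(perm_filterC (pred1 n) s) perm_cat2r /c -size_filter.
  by rewrite -(all_pred1P _ _ (filter_all _ _)) perm_refl.
rewrite gsum_cat addrA -(grams_generatorMp n) !nseqE -mulrnDr subnKC //.
Qed.

Lemma gsum_ge0 s : 0 <= gsum s.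
Proof. by apply: sumr_ge0 => n _; apply: ltW; apply: grams_generator_gt0. Qed.

Lemma dyadic_gsum d : dyadic d -> exists s, d = gsum s.
Proof.
move=> [k [n ->]]; exists (nseq (odd_prime_seq n * k) n).
rewrite /gsum big_nseq iter_addr_0 mulrnA grams_generatorMp.
by rewrite -[RHS]mulr_natl.
Qed.

(** Stated through dyadic divisors rather than through reduced sums, so that the
property passes to divisors at once. *)
Definition pure (z : rat) : Prop :=
  forall d s, dyadic d -> z = d + gsum s -> d = 0.

(** Carrying shortens the sum, so it terminates. *)
Lemma gsum_reduce s :
  exists d t, [/\ dyadic d, reduced t & gsum s = d + gsum t].
Proof.
have [m] := ubnP (size s); elim: m s => // m IHm s; rewrite ltnS => le_sm.
have [rs|/existsNP[n /negP]] := pselect (reduced s).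
  by exists 0, s; rewrite add0r; split=> //; apply: dyadic0.
rewrite -leqNgt => /gsum_carry[t lt_ts ->].
have [d [t' [dd rt' ->]]] := IHm t (leq_trans lt_ts le_sm).
exists ((2 ^+ n)^-1 + d), t'; rewrite addrA; split=> //.
by apply: dyadicD => //; apply: dyadicV.
Qed.

(** Subtracting a dyadic rational from a reduced sum and reducing what remains
would give a second reduced expression. *)
Lemma reduced_pure s : reduced s -> pure (gsum s).
Proof.
move=> rs d t dd sE; have [e [t' [de rt' tE]]] := gsum_reduce t.
have : 0 + gsum s = (d + e) + gsum t' by rewrite add0r sE tE addrA.
move=> /[dup] E /reduced_perm -/(_ dyadic0 (dyadicD _ _ dd de) rs rt') /gsum_perm st.
move: E; rewrite st => /addIr/esym/eqP.
by rewrite paddr_eq0 ?dyadic_ge0 // => /andP[/eqP].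
Qed.

Lemma pure_reduced s : pure (gsum s) -> reduced s.
Proof.
move=> ps n; rewrite ltnNge; apply/negP => /gsum_carry[t _ /ps] -/(_ (dyadicV n)).
by apply/eqP; rewrite invr_eq0 expf_neq0.
Qed.

(** Such sums admit no carry, so both are reduced, and reduced sums are unique. *)
Lemma pure_size s t : pure (gsum s) -> gsum s = gsum t -> size s = size t.
Proof.
move=> ps st; apply: perm_size; apply: (@reduced_perm 0 0);
  rewrite ?add0r //; try exact: dyadic0; first exact: pure_reduced.
by apply: pure_reduced; rewrite -st.
Qed.

(** The divisors of a pure exponent are pure, since divisibility is transitive. *)
Lemma pureDl x s : pure (x + gsum s) -> pure x.
Proof.
by move=> px d t dd xE; apply: (px d (t ++ s)) => //; rewrite xE gsum_cat addrA.
Qed.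

Lemma gsum_pure_part s :
  exists d t, [/\ dyadic d, pure (gsum t) & gsum s = d + gsum t].
Proof.
by have [d [t [dd /reduced_pure]]] := gsum_reduce s; exists d, t.
Qed.

Fact gsum_subproof s : gsum s \in grams_exponent.
Proof. by apply/asboolP; exists s. Qed.

Definition gexp (s : seq nat) : gramsMonoid := GramsMonoid (gsum_subproof s).

Lemma gexp_surj (x : gramsMonoid) : exists s, x = gexp s.
Proof. by have /asboolP[s xE] := valP x; exists s; apply: val_inj. Qed.

Lemma gexp_cat s t : gexp (s ++ t) = mmul (gexp s) (gexp t).
Proof. by apply: val_inj; rewrite /= gsum_cat. Qed.

Lemma gexp0 : gexp [::] = mone.
Proof. by apply: val_inj; rewrite /= /gsum big_nil. Qed.

Lemma gexp_eq s t : gsum s = gsum t -> gexp s = gexp t.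
Proof. by move=> st; apply: val_inj. Qed.

Lemma gexp_eq1 s : gexp s = mone -> s = [::].
Proof.
case: s => // n s /(congr1 val) /= /eqP.
rewrite /gsum big_cons paddr_eq0 ?gsum_ge0 ?ltW ?grams_generator_gt0 //.
by rewrite gt_eqF ?grams_generator_gt0.
Qed.

Lemma mmul_inj (x : gramsMonoid) : injective (mmul x).
Proof. by move=> y z /(congr1 val) /= /addrI yz; apply: val_inj. Qed.

(** The exponent gexp u is the least of the dyadic parts of the members of X; it
divides every other dyadic part because dyadic rationals are totally ordered by
divisibility. *)
Lemma pure_common_divisor (X : seq gramsMonoid) : X != [::] ->
  exists u, (forall x, x \in X -> exists s, x = gexp (u ++ s)) /\
    exists2 s, gexp (u ++ s) \in X & pure (gsum s).
Proof.
suff claim : X != [::] -> exists2 d, dyadic d &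
    (forall x, x \in X -> exists s, val x = d + gsum s) /\
    exists2 x, x \in X & exists2 s, val x = d + gsum s & pure (gsum s).
  move=> /claim[d /dyadic_gsum[u ->] [Xu [x xX [s xE ps]]]]; exists u; split.
    by move=> y /Xu[t yE]; exists t; apply: val_inj; rewrite yE /= gsum_cat.
  exists s => //; rewrite (_ : gexp _ = x) //; apply: val_inj.
  by rewrite /= gsum_cat -xE.
elim: X => // x X IHX _; have [s xE] := gexp_surj x.
have [d [t [dd pt stE]]] := gsum_pure_part s.
have {s xE stE} xE : val x = d + gsum t by rewrite xE /= stE.
have [X0|/IHX [e de [Xe [y yX [r yE pr]]]]] := eqVneq X [::].
  exists d => //; split; last by exists x; [rewrite mem_head | exists t].
  by move=> y; rewrite X0 inE => /eqP->; exists t.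
(* A dyadic divisor may be replaced by a smaller one: the difference is dyadic. *)
have shift d1 d2 s : dyadic d1 -> dyadic d2 -> d1 <= d2 ->
    exists s', d2 + gsum s = d1 + gsum s'.
  move=> D1 D2 d12; have [v vE] := dyadic_gsum _ (dyadicB _ _ D1 D2 d12).
  by exists (v ++ s); rewrite gsum_cat -vE addrA subrKC.
have [de'|/ltW ed] := lerP d e.
  exists d => //; split; last by exists x; [rewrite mem_head | exists t].
  move=> z; rewrite inE => /predU1P[->|/Xe[s ->]]; first by exists t.
  exact: shift.
exists e => //; split; last by exists y; [rewrite inE yX orbT | exists r].
move=> z; rewrite inE => /predU1P[->|/Xe[s ->]]; last by exists s.
by rewrite xE; apply: shift.
Qed.

(** * Exponents of polynomials over the monoid ring *)

Section MonoidRing.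
Variable F : fieldType.
Local Notation A := {malg F[gramsMonoid]}.
Implicit Types (f g u : A) (G H : {poly A}) (s t : seq nat).

Definition tpow (s : seq nat) : A := << gexp s >>.

Lemma tpow_cat s t : tpow (s ++ t) = tpow s * tpow t.
Proof.
by rewrite /tpow malgM_def fgmulUU mulr1 gexp_cat.
Qed.

Lemma tpow0 : tpow [::] = 1.
Proof. by rewrite /tpow gexp0. Qed.

Lemma tpow_eq s t : gsum s = gsum t -> tpow s = tpow t.
Proof. by move=> st; rewrite /tpow (gexp_eq _ _ st). Qed.

Lemma tpow_neq0 s : tpow s != 0.
Proof. by rewrite monalgU_eq0 oner_eq0. Qed.

Lemma mcoeff_tpowM s f k : (tpow s * f)@_(mmul (gexp s) k) = f@_k.
Proof.
rewrite mcoeffMl msuppU1 big_seq_fset1 mcoeffUU.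
under eq_bigr => j _ do rewrite mul1r (inj_eq (mmul_inj _)).
have [kf|kf] := boolP (k \in msupp f); last first.
  rewrite (mcoeff_outdom kf) big_seq big1 // => j jf.
  by case: eqP kf => [<-|]; rewrite ?jf.
rewrite (bigD1_seq k) ?fset_uniq //= eqxx big1 ?addr0 // => j /negPf->.
by rewrite mulr0n.
Qed.

(** Divisibility by a monomial may be tested on each term separately. *)
Lemma tpow_dvd s f : (forall x, f@_x != 0 -> exists t, x = gexp (s ++ t)) ->
  exists g, f = tpow s * g.
Proof.
move=> fs; rewrite [f]monalgE big_seq.
apply: (big_ind (fun f' => exists g, f' = tpow s * g)) => [|_ _ [g1 ->] [g2 ->]|x].
- by exists 0; rewrite mulr0.
- by exists (g1 + g2); rewrite mulrDr.
rewrite -mcoeff_neq0 => /fs[t ->]; exists << f@_(gexp (s ++ t)) *g gexp t >>.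
by rewrite gexp_cat /tpow malgM_def fgmulUU mul1r.
Qed.

Definition occurs (x : gramsMonoid) (G : {poly A}) : Prop :=
  exists i, (G`_i)@_x != 0.

Lemma occurs_seq G : exists X : seq gramsMonoid, forall x, occurs x G <-> x \in X.
Proof.
exists (flatten [seq enum_fset (msupp f) | f : A <- G]) => x; split.
  move=> [i Gx]; apply/flattenP; exists (enum_fset (msupp G`_i)); last first.
    by rewrite mcoeff_neq0 in Gx.
  apply: map_f; apply: mem_nth; rewrite ltnNge; apply: contra Gx => le.
  by rewrite nth_default ?mcoeff0.
move=> /flattenP[_ /mapP[f /(nthP 0)[i lt_i <-] ->]] xf.
by exists i; rewrite mcoeff_neq0.
Qed.

Lemma occurs_ex G : G != 0 -> exists x, occurs x G.
Proof.
move=> G0; have : lead_coef G != 0 by rewrite lead_coef_eq0.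
rewrite -msupp_eq0 => /fset0Pn[x xG]; exists x, (size G).-1.
by rewrite mcoeff_neq0.
Qed.

Lemma occursM x G H : occurs x (G * H) ->
  exists y z, [/\ occurs y G, occurs z H & x = mmul y z].
Proof.
move=> [i]; rewrite coefM raddf_sum /= => nz.
have [j] : exists j : 'I_i.+1, (G`_j * H`_(i - j))@_x != 0.
  apply/existsP; apply: contraNT nz => /existsPn all0.
  by rewrite big1 // => j _; apply/eqP; move: (all0 j); rewrite negbK.
rewrite mcoeff_neq0 => /msuppM_le[y [z [yG zH ->]]].
by exists y, z; split=> //; [exists j | exists (i - j)%N]; rewrite mcoeff_neq0.
Qed.

Lemma pure_factor G : G != 0 -> exists s H, G = (tpow s)%:P * H /\
  exists2 t, occurs (gexp t) H & pure (gsum t).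
Proof.
move=> G0; have [X GX] := occurs_seq G; have [x0 /GX x0X] := occurs_ex _ G0.
have X0 : X != [::] by apply: contraTneq x0X => ->.
have [s [Xs [t tX pt]]] := pure_common_divisor _ X0.
have /choice[h hE] i : exists h, G`_i = tpow s * h.
  by apply: tpow_dvd => x Gx; apply: Xs; apply/GX; exists i.
have GE : G = (tpow s)%:P * \poly_(i < size G) h i.
  apply/polyP => i; rewrite coefCM coef_poly; case: ltnP => [_|le] //.
  by rewrite mulr0 nth_default.
exists s, (\poly_(i < size G) h i); split=> //; exists t => //.
move/GX: tX => [i]; rewrite gexp_cat {1}GE coefCM mcoeff_tpowM => hi.
by exists i.
Qed.

(** Finitely many exponents occur, so one of the pure ones is least for the order
of the rationals. *)
Lemma minimal_pure_occurs H t : occurs (gexp t) H -> pure (gsum t) ->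
  exists t', [/\ occurs (gexp t') H, pure (gsum t') &
    forall r, occurs (gexp r) H -> pure (gsum r) -> gsum t' <= gsum r].
Proof.
move=> tH pt; have [X HX] := occurs_seq H.
suff [x [xX px x_min]] : exists x, [/\ x \in X, pure (val x) &
    forall y, y \in X -> pure (val y) -> val x <= val y].
  have [t' xE] := gexp_surj x; rewrite xE in xX px x_min; exists t'.
  by split=> // [|r /HX]; [apply/HX | exact: x_min].
have {tH pt} : exists2 x, x \in X & pure (val x) by exists (gexp t) => //; apply/HX.
elim: X {HX} => [[//]|x X IHX] [y yX py].
have [[z zX pz]|noX] := pselect (exists2 x, x \in X & pure (val x)); last first.
  have yx : y = x.
    by move: yX; rewrite inE => /predU1P[//|yX]; case: noX; exists y.
  exists x; rewrite mem_head -yx; split=> // z; rewrite inE => /predU1P[->|zX pz].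
    by rewrite yx.
  by case: noX; exists z.
have [|{zX pz}z [zX pz z_min]] := IHX; first by exists z.
have [[px xz]|nx] := pselect (pure (val x) /\ val x <= val z).
  exists x; rewrite mem_head; split=> // w; rewrite inE => /predU1P[->//|wX pw].
  exact: le_trans xz (z_min _ wX pw).
exists z; rewrite inE zX orbT; split=> // w; rewrite inE => /predU1P[-> px|]; last exact: z_min.
by rewrite leNgt; apply/negP => /ltW xz; apply: nx.
Qed.

(** Let t' be the least pure exponent of H.  Any other contribution to t' in u H
comes from an exponent of H that properly divides t'; it would be pure and
smaller. *)
Lemma pure_occurs_stable H t : occurs (gexp t) H -> pure (gsum t) ->
  exists2 t', pure (gsum t') &
    forall u, u@_mone != 0 -> occurs (gexp t') (u%:P * H).
Proof.
move=> tH pt; have {t tH pt}[t [[i tH] pt t_min]] := minimal_pure_occurs _ _ tH pt.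
exists t => // u u0; exists i; rewrite coefCM.
suff -> : (u * H`_i)@_(gexp t) = u@_mone * (H`_i)@_(gexp t) by rewrite mulf_neq0.
rewrite mcoeffMl (bigD1_seq mone) ?fset_uniq //= -?mcoeff_neq0 //.
rewrite (bigD1_seq (gexp t)) ?fset_uniq //= -?mcoeff_neq0 // mul1m eqxx mulr1n.
rewrite [X in _ + X + _]big1 => [|x xt]; last by rewrite mul1m (negPf xt).
rewrite big1 ?addr0 // => x x1; rewrite big_seq big1 // => y.
rewrite -mcoeff_neq0 => yH; case: eqP => // xyt.
have [r xE] := gexp_surj x; have [r' yE] := gexp_surj y.
have E : gsum t = gsum r' + gsum r.
  by rewrite addrC; move/(congr1 val): xyt; rewrite xE yE.
have pr : pure (gsum r') by apply: (pureDl _ r); rewrite -E.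
have : gsum t <= gsum r' by apply: t_min => //; exists i; rewrite -yE.
rewrite E gerDl => r0; case/eqP: x1; rewrite xE; apply: val_inj => /=.
by apply/eqP; rewrite eq_le r0 gsum_ge0.
Qed.

(** When G is constant in x, this says that it lies in the k-th power of the ideal
generated by the monomials other than 1. *)
Definition deep (k : nat) (G : {poly A}) : Prop :=
  forall x, occurs x G -> exists2 s, (k <= size s)%N & x = gexp s.

Lemma deep0 G : deep 0 G.
Proof. by move=> x _; have [s ->] := gexp_surj x; exists s. Qed.

Lemma deepM k l G H : deep k G -> deep l H -> deep (k + l) (G * H).
Proof.
move=> kG lH x /occursM[y [z [/kG[s ks ->] /lH[t lt_ ->] ->]]].
by exists (s ++ t); rewrite ?gexp_cat // size_cat leq_add.
Qed.

(** A test on representatives over the monoid ring for not being a unit in the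
polynomial ring over the localization: a constant with nonzero constant
coefficient is excluded. *)
Definition noninvertible G : Prop := (size G <= 1)%N -> (G`_0)@_mone = 0.

(** Each factor contributes to one of two budgets: a constant factor raises the
depth, any other one raises the degree. *)
Lemma deep_prod (L : seq {poly A}) : \prod_(G <- L) G != 0 ->
  (forall G, G \in L -> noninvertible G) ->
  exists2 k, deep k (\prod_(G <- L) G) & (size L < k + size (\prod_(G <- L) G)%R)%N.
Proof.
elim: L => [_ _|G L IHL].
  by exists 0%N; [exact: deep0 | rewrite big_nil size_poly1].
rewrite big_cons; set P := \prod_(G <- L) G in IHL *.
rewrite mulf_eq0 negb_or => /andP[G0 P0] GL.
have [|k kP lt_k] := IHL P0; first by move=> H HL; apply: GL; rewrite inE HL orbT.
have [G1|G1] := leqP (size G) 1; last first.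
  exists (0 + k)%N; first by apply: deepM => //; apply: deep0.
  rewrite size_mul //=; case: (size G) G1 => [//|[//|n]] _.
  by rewrite addSn /= addSn addnS ltnS (leq_trans lt_k) // leq_add2l leq_addl.
exists (1 + k)%N; last first.
  rewrite size_mul //= (_ : size G = 1%N) //.
  by apply/anti_leq; rewrite G1 lt0n size_poly_eq0.
apply: deepM => // x [i]; have := GL G (mem_head _ _) G1.
case: i => [|i] G00; last by rewrite nth_default ?mcoeff0 ?eqxx // (leq_trans G1).
have [[|n s] ->] := gexp_surj x; first by rewrite gexp0 G00 eqxx.
by exists (n :: s).
Qed.

(** The depth of the product is at most the length of its pure exponent t, as all
expressions of t as a sum of generators have that length. *)
Lemma size_factorization t (L : seq {poly A}) :
  pure (gsum t) -> occurs (gexp t) (\prod_(G <- L) G) ->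
  (forall G, G \in L -> noninvertible G) ->
  (size L < size t + size (\prod_(G <- L) G)%R)%N.
Proof.
move=> pt tL; have : \prod_(G <- L) G != 0.
  by apply/eqP => L0; case: tL => i; rewrite L0 coef0 mcoeff0 eqxx.
move=> /deep_prod/[apply] -[k /(_ _ tL)[s ks /(congr1 val) /= tE] lt_k].
by apply: leq_trans lt_k _; rewrite leq_add2r (pure_size _ _ pt tE).
Qed.

End MonoidRing.

(** * Factorization into irreducibles from bounded lengths *)

Section AlmostFactorization.
Variable D : idomainType.
Implicit Types a b : D.

(** Allowing a unit in front makes this property closed under multiplication and
true of units as well. *)
Definition factorable a : Prop := exists w s, [/\ w \is a GRing.unit,
  (forall b, b \in s -> irreducible_elt b) & a = w * \prod_(b <- s) b].

Lemma factorable_unit a : a \is a GRing.unit -> factorable a.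
Proof. by move=> ua; exists a, [::]; split=> //; rewrite big_nil mulr1. Qed.

Lemma factorable_irreducible a : irreducible_elt a -> factorable a.
Proof.
move=> ia; exists 1, [:: a]; rewrite unitr1 mul1r big_seq1; split=> // b.
by rewrite inE => /eqP->.
Qed.

Lemma factorableM a b : factorable a -> factorable b -> factorable (a * b).
Proof.
move=> [v [s [uv si ->]]] [w [t [uw ti ->]]]; exists (v * w), (s ++ t).
split; [by rewrite unitrM uv | | by rewrite big_cat mulrACA].
by move=> c; rewrite mem_cat => /orP[/si|/ti].
Qed.

Lemma irreducible_unitM w a :
  w \is a GRing.unit -> irreducible_elt a -> irreducible_elt (w * a).
Proof.
move=> uw [a0 na ia]; have w0 : w != 0 by apply: contraTneq uw => ->; rewrite unitr0.
split; [by rewrite mulf_neq0 | by rewrite unitrM uw | move=> b c wabc].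
have /ia : a = (w^-1 * b) * c by rewrite -mulrA -wabc mulKr.
by case; [rewrite unitrM unitrV uw; left | right].
Qed.

Lemma atomic_factorable : (forall a, a != 0 -> factorable a) -> atomic D.
Proof.
move=> facD a /facD[w [[|b s] [uw si aE]]] na.
  by rewrite aE big_nil mulr1 uw in na.
exists (w * b :: s); split=> [c|]; last by rewrite aE !big_cons mulrA.
rewrite inE => /predU1P[->|cs]; last by apply: si; rewrite inE cs orbT.
by apply: irreducible_unitM => //; apply: si; rewrite mem_head.
Qed.

(** A reducible element splits into two nonunits, and each of them has a smaller
bound on the lengths of its factorizations. *)
Lemma factorable_bounded n a : a != 0 ->
  (forall s, (forall b, b \in s -> b \isn't a GRing.unit) ->
     a = \prod_(b <- s) b -> (size s <= n)%N) ->
  factorable a.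
Proof.
elim: n a => [|n IHn] a a0 bnd; have [/factorable_unit//|na] := boolP (a \is a GRing.unit).
  suff : (size [:: a] <= 0)%N by [].
  by apply: bnd => [b|]; rewrite ?big_seq1 // inE => /eqP->.
have [/factorable_irreducible //|] := pselect (irreducible_elt a).
move=> ni; have [b [c [aE nb nc]]] : exists b c,
    [/\ a = b * c, b \isn't a GRing.unit & c \isn't a GRing.unit].
  apply: contrapT => nbc; apply: ni; split=> // b c aE.
  apply: contrapT => nu; apply: nbc; exists b, c; split=> //; apply/negP => u;
    apply: nu; [by left | by right].
have sub x y : a = x * y -> y \isn't a GRing.unit -> factorable x.
  move=> xyE ny; apply: IHn => [|s ns xE].
    by apply: contraNneq a0 => x0; rewrite xyE x0 mul0r.
  rewrite -ltnS; apply: (bnd (y :: s)); last by rewrite big_cons -xE mulrC.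
  by move=> z; rewrite inE => /predU1P[->|/ns].
rewrite aE; apply: factorableM; first exact: sub nc.
by apply: sub nb; rewrite mulrC.
Qed.

End AlmostFactorization.

(** * Polynomials with values in a subring *)

(** Newton interpolation: p - p(a0) = q (x - a0), and q takes values in S on C
minus a0 because differences of elements of C are invertible in S.  Removing a
point keeps C infinite while the degree drops. *)
Lemma interpolation (K : fieldType) (S : subringClosed K) (C : set K)
    (p : {poly K}) : infinite_set C ->
  (forall a b, C a -> C b -> a != b -> (a - b)^-1 \in S) ->
  (forall a, C a -> a \in S) -> (forall a, C a -> p.[a] \in S) ->
  p \is a polyOver S.
Proof.
have [n] := ubnP (size p); elim: n C p => // n IHn C p; rewrite ltnS => le_pn Cinf.
move=> CV CS pS; have [a0 Ca0] := infinite_setN0 Cinf.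
have /factor_theorem[q qE] : root (p - p.[a0]%:P) a0.
  by rewrite rootE hornerD hornerN hornerC subrr.
rewrite -[p](subrK p.[a0]%:P) qE rpredD ?polyOverC ?pS //.
rewrite rpredM ?polyOverXsubC ?CS //.
have [->|q0] := eqVneq q 0; first exact: rpred0.
apply: (IHn (C `\ a0)) => [||a b [Ca _] [Cb _]|a [/CS]|a [Ca /eqP aa0]] //.
- have [p1|p1] := leqP (size p) 1.
    suff : q * ('X - a0%:P) = 0 by move/eqP; rewrite mulf_eq0 (negPf q0) polyXsubC_eq0.
    by rewrite -qE [p]size1_polyC // hornerC subrr.
  have := size_Mmonic q0 (monicXsubC a0); rewrite size_XsubC addn2 /= => sq.
  apply: leq_trans le_pn; rewrite -sq -qE size_polyDl // size_polyN.
  by rewrite (leq_ltn_trans (size_polyC_leq1 _)).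
- exact/infinite_setD.
- exact: CV.
have nz : a - a0 != 0 by rewrite subr_eq0.
have := congr1 (fun r => r.[a]) qE; rewrite hornerM hornerXsubC hornerD hornerN hornerC.
move=> /esym/(canRL (mulfK nz))->; rewrite rpredM ?rpredB ?pS ?CV //.
Qed.

(** * The monoid ring inside its localization *)

Section Embedding.
Variable F : fieldType.
Local Notation A := {malg F[gramsMonoid]}.
Local Notation R := (gramsRing F).
Local Notation tofrac := (@FracField.tofrac _).

Fact grams_emb_subproof (f : A) : tofrac f \in @grams_fraction F.
Proof. by apply/asboolP; exists f, 1; rewrite rmorph1 oner_neq0 rmorph1 divr1. Qed.

Definition grams_emb (f : A) : R := GramsRing (grams_emb_subproof f).

Fact grams_emb_zmod_morphism : zmod_morphism grams_emb.
Proof. by move=> f g; apply: val_inj; rewrite /= rmorphB. Qed.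
Fact grams_emb_monoid_morphism : monoid_morphism grams_emb.
Proof. by split=> [|f g]; apply: val_inj; rewrite /= ?rmorph1 // rmorphM. Qed.
HB.instance Definition _ := GRing.isZmodMorphism.Build A R grams_emb grams_emb_zmod_morphism.
HB.instance Definition _ := GRing.isMonoidMorphism.Build A R grams_emb grams_emb_monoid_morphism.

Lemma grams_emb_inj : injective grams_emb.
Proof. by move=> f g /(congr1 val) /= /eqP; rewrite tofrac_eq => /eqP. Qed.

Lemma grams_emb_unit (u : A) : u@_mone != 0 -> exists v, grams_emb u * v = 1.
Proof.
move=> u0; have vP : tofrac 1 / tofrac u \in @grams_fraction F by apply/asboolP; exists 1, u.
exists (GramsRing vP); apply: val_inj => /=; rewrite rmorph1 mul1r divff //.
by rewrite tofrac_eq0; apply: contraNneq u0 => ->; rewrite mcoeff0.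
Qed.

Lemma grams_emb_denominator (x : R) :
  exists u f : A, u@_mone != 0 /\ grams_emb u * x = grams_emb f.
Proof.
have /asboolP[f [u [u0 xE]]] := valP x; exists u, f; split=> //.
apply: val_inj; rewrite /= [gramsRing_val x]xE mulrC mulfVK //.
by rewrite tofrac_eq0; apply: contraNneq u0 => ->; rewrite mcoeff0.
Qed.

End Embedding.

(** * Integer-valued polynomials over the localization *)

(** From here on the localization is an arbitrary domain R with a morphism from
the monoid ring that satisfies the next three properties, so that neither the
construction of its elements as fractions nor that of its field of fractions
gets unfolded. *)
Section Localization.
Variable F : fieldType.
Local Notation A := {malg F[gramsMonoid]}.
Local Notation tofrac := (@FracField.tofrac _).

Variables (R : idomainType) (emb : {rmorphism A -> R}).
Hypothesis emb_inj : injective emb.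
Hypothesis emb_unit : forall u : A, u@_mone != 0 -> exists v, emb u * v = 1.
Hypothesis emb_denominator : forall x : R,
  exists u f : A, u@_mone != 0 /\ emb u * x = emb f.

Lemma poly_denominator (p : {poly R}) :
  exists (u : A) (G : {poly A}), u@_mone != 0 /\ emb u *: p = map_poly emb G.
Proof.
elim/poly_ind: p => [|p c [u [G [u0 GE]]]].
  by exists 1, 0; rewrite rmorph1 oner_neq0 scaler0 rmorph0.
have [v [f [v0 fE]]] := emb_denominator c.
exists (v * u), (v%:P * G * 'X + (u * f)%:P); split.
  by rewrite rmorphM mulf_neq0.
rewrite !rmorphD !rmorphM /= map_polyX !map_polyC /= -GE -fE.
by rewrite -!mul_polyC !rmorphM /=; ring.
Qed.

Definition fracint : {pred {fraction R}} := fun x => `[< exists b, x = tofrac b >].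

Fact fracint_subring : subring_closed fracint.
Proof.
split=> [|_ _ /asboolP[b ->] /asboolP[c ->]|_ _ /asboolP[b ->] /asboolP[c ->]];
  apply/asboolP; first by exists 1; rewrite rmorph1.
  by exists (b - c); rewrite rmorphB.
by exists (b * c); rewrite rmorphM.
Qed.
HB.instance Definition _ :=
  GRing.isSubringClosed.Build _ fracint fracint_subring.

Lemma polyOver_fracint (p : {poly {fraction R}}) :
  p \is a polyOver fracint -> exists q : {poly R}, p = map_poly tofrac q.
Proof.
move=> /polyOverP pS; have /choice[f fE] i : exists b, p`_i = tofrac b.
  exact/asboolP/pS.
exists (\poly_(i < size p) f i); apply/polyP => i; rewrite coef_map coef_poly.
by case: ltnP => [_|le]; [exact: fE | rewrite nth_default // rmorph0].
Qed.

Lemma int_valued_polyP (p : {poly {fraction R}}) : infinite_set [set: F] ->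
  p \in int_valued R <-> exists q : {poly R}, p = map_poly tofrac q.
Proof.
move=> Finf; split=> [/asboolP pP|[q ->]]; last first.
  by apply/asboolP => a; exists q.[a]; rewrite horner_map.
pose cst (c : F) := tofrac (emb c%:MP).
have cst_inj : injective cst.
  by move=> a b /eqP; rewrite tofrac_eq (inj_eq emb_inj) malgC_eq => /eqP.
have cst0 : cst 0 = 0 by rewrite /cst !rmorph0.
have cstB a b : cst (a - b) = cst a - cst b by rewrite /cst !rmorphB.
apply/polyOver_fracint/(interpolation _ _ (range cst)).
- move=> fin; apply: Finf; rewrite -(preimage_range cst).
  by apply: finite_preimage fin => a b _ _; apply: cst_inj.
- move=> _ _ [a _ <-] [b _ <-]; rewrite -cstB (inj_eq cst_inj) -subr_eq0 => ab.
  have nz : cst (a - b) != 0 by rewrite -cst0 (inj_eq cst_inj).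
  apply/asboolP; exists (emb ((a - b)^-1)%:MP); apply: (mulfI nz).
  by rewrite divff // -!rmorphM divff // !rmorph1.
- by move=> _ [a _ <-]; apply/asboolP; exists (emb a%:MP).
- by move=> _ [a _ <-]; apply/asboolP/pP.
Qed.

Fact intPoly_of_poly_subproof (p : {poly R}) : map_poly tofrac p \in int_valued R.
Proof. by apply/asboolP => a; exists p.[a]; rewrite horner_map. Qed.

Definition intPoly_of_poly (p : {poly R}) : intPoly R :=
  IntPoly (intPoly_of_poly_subproof p).

Lemma intPoly_of_polyM : {morph intPoly_of_poly : p q / p * q}.
Proof. by move=> p q; apply: val_inj; rewrite /= rmorphM. Qed.

Lemma intPoly_of_poly1 : intPoly_of_poly 1 = 1.
Proof. by apply: val_inj; rewrite /= rmorph1. Qed.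

Lemma intPoly_of_poly_inj : injective intPoly_of_poly.
Proof.
by move=> p q /(congr1 val) /=; apply: map_inj_poly => [x y /eqP|];
  rewrite ?rmorph0 // tofrac_eq => /eqP.
Qed.

Definition intPoly_of_malg (G : {poly A}) : intPoly R :=
  intPoly_of_poly (map_poly emb G).

Lemma intPoly_of_malgM : {morph intPoly_of_malg : G H / G * H}.
Proof. by move=> G H; rewrite /intPoly_of_malg rmorphM intPoly_of_polyM. Qed.

Lemma intPoly_of_malg1 : intPoly_of_malg 1 = 1.
Proof. by rewrite /intPoly_of_malg rmorph1 intPoly_of_poly1. Qed.

Lemma intPoly_of_malg_inj : injective intPoly_of_malg.
Proof. by move=> G H /intPoly_of_poly_inj; apply: map_inj_poly; rewrite ?rmorph0. Qed.

Lemma intPoly_of_malg_unit (u : A) :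
  u@_mone != 0 -> intPoly_of_malg u%:P \is a GRing.unit.
Proof.
move=> /emb_unit[v uv]; apply/unitrPr; exists (intPoly_of_poly v%:P).
rewrite /intPoly_of_malg map_polyC /= -intPoly_of_polyM -polyCM uv.
by rewrite intPoly_of_poly1.
Qed.

Hypothesis Finf : infinite_set [set: F].

(** This is where the field F has to be infinite: integer-valued polynomials have
coefficients in R, hence a common denominator. *)
Lemma intPoly_of_malg_denominator (P : intPoly R) : exists (u : A) (G : {poly A}),
  u@_mone != 0 /\ intPoly_of_malg u%:P * P = intPoly_of_malg G.
Proof.
have /(int_valued_polyP _ Finf)[p pE] := valP P.
have [u [G [u0 GE]]] := poly_denominator p.
exists u, G; split=> //; have -> : P = intPoly_of_poly p by apply: val_inj.
by rewrite /intPoly_of_malg -GE map_polyC -intPoly_of_polyM mul_polyC.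
Qed.

(** If G y = 1 and u is a denominator of y, then u = G H for some H over the
monoid ring; degrees force G to be constant, and taking constant coefficients
gives u(0) = 0. *)
Lemma noninvertible_nonunit (G : {poly A}) : noninvertible _ G ->
  intPoly_of_malg G \isn't a GRing.unit.
Proof.
move=> nG; apply/negP => /unitrPr[y Gy1].
have [u [H [u0 HE]]] := intPoly_of_malg_denominator y.
have /intPoly_of_malg_inj uGH : intPoly_of_malg u%:P = intPoly_of_malg (G * H).
  by rewrite intPoly_of_malgM -HE mulrCA Gy1 mulr1.
have u_neq0 : u != 0 by apply: contraNneq u0 => ->; rewrite mcoeff0.
have GH0 : G * H != 0 by rewrite -uGH polyC_eq0.
have /andP[G0 H0] : (G != 0) && (H != 0) by rewrite -negb_or -mulf_eq0.
have sG : (size G <= 1)%N.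
  have : (size (G * H)%R <= 1)%N by rewrite -uGH size_polyC_leq1.
  rewrite size_mul //; rewrite -size_poly_gt0 in H0; move: H0.
  case: (size H) => // m _; rewrite addnS /=; apply: leq_trans; exact: leq_addr.
have := congr1 (fun P : {poly A} => P`_0) uGH; rewrite coefC eqxx coef0M => uE.
by move/eqP: u0; apply; rewrite uE rmorphM /= (nG sG) mul0r.
Qed.

Lemma nonunit_noninvertible (P : intPoly R) u G : u@_mone != 0 ->
  P \isn't a GRing.unit -> intPoly_of_malg u%:P * P = intPoly_of_malg G ->
  noninvertible _ G.
Proof.
move=> u0 nP GE sG; apply/eqP/negPn/negP => G0; case/negP: nP.
have : intPoly_of_malg G \is a GRing.unit.
  by rewrite [G]size1_polyC // intPoly_of_malg_unit.
by rewrite -GE unitrM => /andP[].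
Qed.

(** Clearing denominators turns a factorization into nonunits into a factorization
of the same length over the monoid ring. *)
Lemma prod_denominator (s : seq (intPoly R)) :
  (forall P, P \in s -> P \isn't a GRing.unit) ->
  exists u (L : seq {poly A}), [/\ u@_mone != 0, size L = size s,
    forall G, G \in L -> noninvertible _ G &
    intPoly_of_malg u%:P * \prod_(P <- s) P = intPoly_of_malg (\prod_(G <- L) G)].
Proof.
elim: s => [_|P s IHs sN].
  by exists 1, [::]; rewrite !big_nil mulr1 rmorph1 oner_neq0.
have [Q Qs|u [L [u0 sL LN LE]]] := IHs; first by apply: sN; rewrite inE Qs orbT.
have [v [G [v0 GE]]] := intPoly_of_malg_denominator P.
exists (v * u), (G :: L); split=> [||H|].
- by rewrite rmorphM mulf_neq0.
- by rewrite /= sL.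
- rewrite inE => /predU1P[->|/LN //].
  by apply: nonunit_noninvertible GE => //; apply: sN; rewrite mem_head.
by rewrite !big_cons intPoly_of_malgM polyCM intPoly_of_malgM -GE -LE mulrACA.
Qed.

Lemma factorization_bound H t : occurs _ (gexp t) H -> pure (gsum t) ->
  exists n, forall u (L : seq {poly A}), u@_mone != 0 ->
    (forall G, G \in L -> noninvertible _ G) ->
    u%:P * H = \prod_(G <- L) G -> (size L <= n)%N.
Proof.
move=> tH pt; have [t' pt' t'H] := pure_occurs_stable _ _ _ tH pt.
exists (size t' + size H)%N => u L u0 LN uHE.
have := size_factorization _ t' L pt'; rewrite -uHE => /(_ (t'H u u0) LN).
have u_neq0 : u != 0 by apply: contraNneq u0 => ->; rewrite mcoeff0.
by rewrite mul_polyC size_scale // => /ltnW.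
Qed.

Lemma intPoly_of_malg_eq0 G : (intPoly_of_malg G == 0) = (G == 0).
Proof.
have <- : intPoly_of_malg 0 = 0 by apply: val_inj; rewrite /= !rmorph0.
exact: inj_eq intPoly_of_malg_inj _ _.
Qed.

Lemma tpow_nonunit s :
  s != [::] -> intPoly_of_malg (tpow F s)%:P \isn't a GRing.unit.
Proof.
move=> s0; apply: noninvertible_nonunit => _; rewrite coefC eqxx mcoeffU1.
by case: eqP => // /gexp_eq1 s0'; rewrite s0' in s0.
Qed.

(** A generator is a pure exponent of length 1, so two nonunit factors are
already too many. *)
Lemma tpow_gen_irreducible n :
  irreducible_elt (intPoly_of_malg (tpow F [:: n])%:P).
Proof.
split; [by rewrite intPoly_of_malg_eq0 polyC_eq0 tpow_neq0 | exact: tpow_nonunit |].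
move=> P Q PQ; apply: contrapT => nPQ.
have [|u [L [u0 sL LN LE]]] := prod_denominator [:: P; Q].
  move=> B; rewrite !inE => /orP[] /eqP->; apply/negP => BU; apply: nPQ;
    [by left | by right].
have {LE} LE : u%:P * (tpow F [:: n])%:P = \prod_(G <- L) G.
  by apply: intPoly_of_malg_inj; rewrite -LE intPoly_of_malgM PQ big_cons big_seq1.
have pn : pure (gsum [:: n]).
  apply: reduced_pure => m; rewrite /= addn0.
  exact: leq_ltn_trans (leq_b1 _) (leq_trans _ (odd_prime_seq_ge3 m)).
have := size_factorization _ _ L pn; rewrite -LE => /(_ _ LN).
have u_neq0 : u != 0 by apply: contraNneq u0 => ->; rewrite mcoeff0.
rewrite mul_polyC size_scale // size_polyC tpow_neq0 sL => /(_ _)/negP; apply => //.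
exists 0%N; rewrite coefZ coefC eqxx mulrC -[gexp _]mulm1 mcoeff_tpowM //.
Qed.

Lemma tpow_factorable s : factorable _ (intPoly_of_malg (tpow F s)%:P).
Proof.
elim: s => [|n s IHs].
  by rewrite tpow0 intPoly_of_malg1; apply: factorable_unit; rewrite unitr1.
rewrite (tpow_cat F [:: n] s) polyCM intPoly_of_malgM; apply: factorableM IHs.
exact/factorable_irreducible/tpow_gen_irreducible.
Qed.

Lemma intPoly_of_malg_factorable G : G != 0 -> factorable _ (intPoly_of_malg G).
Proof.
move=> /pure_factor[s [H [-> [t tH pt]]]]; rewrite intPoly_of_malgM.
apply: factorableM; first exact: tpow_factorable.
have [n bnd] := factorization_bound _ _ tH pt.
apply: (factorable_bounded _ n) => [|S SN HE].
  rewrite intPoly_of_malg_eq0; apply/eqP => H0; case: tH => i; rewrite H0 coef0 mcoeff0.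
  by rewrite eqxx.
have [u [L [u0 <- LN LE]]] := prod_denominator _ SN.
by apply: (bnd u) => //; apply: intPoly_of_malg_inj; rewrite -LE intPoly_of_malgM HE.
Qed.

Lemma intPoly_atomic : atomic (intPoly R).
Proof.
apply: atomic_factorable => P P0.
have [u [G [u0 GE]]] := intPoly_of_malg_denominator P.
have uu := intPoly_of_malg_unit _ u0.
have -> : P = (intPoly_of_malg u%:P)^-1 * intPoly_of_malg G by rewrite -GE mulKr.
apply: factorableM; first by apply: factorable_unit; rewrite unitrV.
apply: intPoly_of_malg_factorable; rewrite -intPoly_of_malg_eq0 -GE mulf_neq0 //.
by apply: contraTneq uu => ->; rewrite unitr0.
Qed.

(** The sum of p_n copies of the n-th generator is 1/2^n, so a n is the monomial
with exponent 1/2^n and a n = (a n.+1)^2. *)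
Lemma intPoly_not_ACCP : ~ ACCP (intPoly R).
Proof.
pose h n := nseq (odd_prime_seq n) n.
have hE n : gsum (h n) = (2 ^+ n)^-1.
  by rewrite /gsum big_nseq iter_addr_0 grams_generatorMp.
pose a n := intPoly_of_malg (tpow F (h n))%:P.
have aE n : a n = a n.+1 * a n.+1.
  rewrite /a -intPoly_of_malgM -polyCM -tpow_cat; congr (intPoly_of_malg _%:P).
  apply: tpow_eq.
  rewrite gsum_cat !hE exprS invfM.
  by rewrite -mulrDl -{1 2}[2^-1]mul1r -mulrDl divff // mul1r.
move=> /(_ a)[n b [c ->]|N stab].
  by exists (c * a n.+1); rewrite aE mulrA.
have : principal_ideal (a N.+1) (a N.+1) by exists 1; rewrite mul1r.
rewrite stab // => -[c]; rewrite [a N]aE mulrA => acE.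
have aN0 : a N.+1 != 0 by rewrite intPoly_of_malg_eq0 polyC_eq0 tpow_neq0.
suff /negP : a N.+1 \isn't a GRing.unit.
  apply; apply/unitrPr; exists c; apply: (mulIf aN0).
  by rewrite mul1r [RHS]acE [a _ * c]mulrC.
apply: tpow_nonunit.
by rewrite -size_eq0 size_nseq -lt0n prime_gt0 ?odd_prime_seq_prime.
Qed.

End Localization.

(** * The theorem *)

Lemma pchar0_infinite (F : fieldType) : [pchar F] =i pred0 -> infinite_set [set: F].
Proof.
move=> F0 Ffin; have natF0 n : (0 < n)%N -> n%:R != 0 :> F.
  move=> n0; apply/negP => nF0.
  by have [p] := natf0_pchar n0 nF0; rewrite F0.
have nat_inj : injective (fun n : nat => n%:R : F).
  have le m n : m%:R = n%:R :> F -> (n <= m)%N.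
    move=> mnE; rewrite leqNgt; apply/negP => lt_mn.
    have /natF0 : (0 < n - m)%N by rewrite subn_gt0.
    by rewrite natrB 1?ltnW // mnE subrr eqxx.
  by move=> m n mnE; apply/anti_leq; rewrite !le.
apply: infinite_nat; rewrite -(preimage_setT (fun n : nat => n%:R : F)).
by apply: finite_preimage Ffin => m n _ _; apply: nat_inj.
Qed.

Theorem proposition3p6 (F : fieldType) :
  ([pchar F] =i pred0 -> infinite_set [set: F]) /\
  (infinite_set [set: F] ->
     [/\ [set p | p \in int_valued (gramsRing F)]
           = range (map_poly (@FracField.tofrac (gramsRing F))),
         atomic (intPoly (gramsRing F))
       & ~ ACCP (intPoly (gramsRing F))]).
Proof.
split; first exact: pchar0_infinite.
have inj := grams_emb_inj F; have unit_emb := grams_emb_unit F.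
have den := grams_emb_denominator F.
move=> Finf; split.
- apply/seteqP; split=> p /=.
    move=> /(int_valued_polyP F (gramsRing F) (grams_emb F) inj p Finf)[q ->].
    by exists q.
  move=> [q _ <-]; apply/(int_valued_polyP F (gramsRing F) (grams_emb F) inj _ Finf).
  by exists q.
- exact: (intPoly_atomic F (gramsRing F) (grams_emb F) inj unit_emb den Finf).
- exact: (intPoly_not_ACCP F (gramsRing F) (grams_emb F) inj den Finf).
Qed.
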